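(* Let $V$ and $W$ be normed linear spaces, let $T : V \to W$ be a bounded linear operator, and let $(T_n)_{n \in \mathbb{N}}$ be a sequence of maps $T_n : V \to W$ (not necessarily linear or continuous). Suppose that $(T_n)$ is consistent with $T$. Then $(T_n)$ converges to $T$ if and only if $(T_n)$ is stable.
   Context: Definitions: - $(T_n)$ converges to $T$ (is convergent) if for every $v \in V$ the sequence $T_n v$ converges to $T v$ in $W$, i.e. for each $v \in V$ and $\epsilon > 0$ there is $n_0 \in \mathbb{N}$ such that $\Vert T_n v - T v \Vert \le \epsilon$ for all $n \ge n_0$. - $(T_n)$ is consistent with $T$ if there is a dense linear subspace $V_0$ of $V$ such that $T_n v$ converges to $T v$ in $W$ for every $v \in V_0$. - $(T_n)$ is stable at $v_0 \in V$ if for every $\epsilon > 0$ there is $\delta > 0$ such that for each $v \in V$ with $\Vert v - v_0 \Vert \le \delta$ there exists $n_0 \in \mathbb{N}$ (which may depend on $v$) such that $\Vert T_n v - T_n v_0 \Vert \le \epsilon$ for all $n \ge n_0$. $(T_n)$ is stable if it is stable at every $v_0 \in V$. *)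

(* Defs.v *)
From HB Require Import structures.
From mathcomp Require Export all_boot all_order all_algebra.
From mathcomp Require Export boolp classical_sets topology normedtype sequences.

Set Implicit Arguments.
Unset Strict Implicit.
Unset Printing Implicit Defensive.

Import Order.TTheory GRing.Theory Num.Theory.
Import numFieldNormedType.Exports.

Local Open Scope classical_set_scope.
Local Open Scope ring_scope.

(* The scalars range over an arbitrary numFieldType, so that real and complex
   normed spaces are both covered; norms take values in K, and [0 < eps] in a
   complex K says that eps is a positive real. *)
Section OperatorSequences.
Context {K : numFieldType} {V W : normedModType K}.

Definition bounded_operator (T : V -> W) : Prop :=
  exists M : K, forall v : V, `|T v| <= M * `|v|.

Definition linear_subspace (V0 : set V) : Prop := submod_closed [in V0].

Definition converges_to (Tn : nat -> V -> W) (T : V -> W) : Prop :=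
  forall v : V, Tn ^~ v @ \oo --> T v.

Definition consistent_with (Tn : nat -> V -> W) (T : V -> W) : Prop :=
  exists V0 : set V, [/\ linear_subspace V0, dense V0 &
    forall v : V, V0 v -> Tn ^~ v @ \oo --> T v].

Definition stable_at (Tn : nat -> V -> W) (v0 : V) : Prop :=
  forall eps : K, 0 < eps ->
  exists2 delta : K, 0 < delta &
  forall v : V, `|v - v0| <= delta ->
  \forall n \near \oo, `|Tn n v - Tn n v0| <= eps.

Definition stable (Tn : nat -> V -> W) : Prop :=
  forall v0 : V, stable_at Tn v0.

End OperatorSequences.

(* Main.v *)
Require Import Defs.

Import Order.TTheory GRing.Theory Num.Theory.
Import numFieldNormedType.Exports.
Local Open Scope classical_set_scope.
Local Open Scope ring_scope.

(** Both directions are three-epsilon arguments: the points [Tn n v] and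
    [Tn n v0] are compared through [T v] and [T v0], with [T v] close to [T v0]
    by continuity of [T] ([bounded_operator_continuous]).  If [Tn] converges
    to [T], the two outer errors vanish as [n] grows, which leaves the
    continuity modulus of [T] as a stability modulus for [Tn]
    ([converges_to_stable]).  Conversely, the convergence at [v0] is borrowed
    from a point [v] of the dense subspace where consistency gives it, [v] being
    so close to [v0] that stability and continuity control both transfers
    ([stable_converges_to]). *)

Lemma ler_dist3_split (K : numFieldType) (W : normedModType K) (b c a d : W)
    (eps : K) :
  `|a - b| <= eps / 3%:R -> `|b - c| <= eps / 3%:R -> `|c - d| <= eps / 3%:R ->
  `|a - d| <= eps.
Proof.
move=> ab bc cd.
have -> : eps = eps / 3%:R + (eps / 3%:R + eps / 3%:R).
  by rewrite -!mulrDl -mulr2n -mulrS -[eps *+ _]mulr_natr mulfK ?pnatr_eq0.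
rewrite (le_trans (ler_distD b a d)) ?lerD//.
by rewrite (le_trans (ler_distD c b d)) ?lerD.
Qed.

Lemma bounded_operator_continuous (K : numFieldType) (V W : normedModType K)
    (T : {linear V -> W}) :
  bounded_operator T -> continuous T.
Proof.
move=> [M TM]; apply/linear_bounded_continuous/linear_boundedP.
(* When V is trivial, M may be negative or not even real, so it is replaced by
   its norm: M * `|x| is nonnegative because it dominates a norm. *)
have TnormM x : `|T x| <= `|M| * `|x|.
  have M0 : 0 <= M * `|x| by exact: le_trans (TM x).
  by rewrite -[X in _ * X]normr_id -normrM ger0_norm.
exists `|M|; split; first exact: normr_real.
by move=> r /ltW Mr x; apply: le_trans (TnormM x) _; rewrite ler_wpM2r.
Qed.

(** A radius within which [T] varies by at most [eps / 3] serves as the stability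
    radius for [Tn]: at a fixed [v] in that ball, the errors of [Tn] at [v] and
    at [v0] are eventually at most [eps / 3].  The rank from which this holds
    depends on [v], as stability permits. *)
Lemma converges_to_stable (K : numFieldType) (V W : normedModType K)
    (T : V -> W) (Tn : nat -> V -> W) :
  continuous T -> converges_to Tn T -> stable Tn.
Proof.
move=> Tcont TnT v0 eps eps0.
have e3 : 0 < eps / 3%:R by rewrite divr_gt0 ?ltr0n.
have /nbhs_normP[d /= d0 Td] : \forall v \near v0, `|T v0 - T v| <= eps / 3%:R.
  by move: (Tcont v0) => /cvgrPdist_le; exact.
(* The ball given by continuity is open, whereas stability quantifies over
   a closed one; hence the halved radius. *)
exists (d / 2%:R); first by rewrite divr_gt0 ?ltr0n.
move=> v vd.
have {vd}Tv : `|T v0 - T v| <= eps / 3%:R.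
  apply: Td => /=; rewrite distrC (le_lt_trans vd)//.
  by rewrite ltr_pdivrMr ?ltr0n// ltr_pMr// ltr1n.
have /cvgrPdist_le/(_ _ e3) TnTv := TnT v.
have /cvgrPdist_le/(_ _ e3) TnTv0 := TnT v0.
near=> n; apply: (@ler_dist3_split _ _ (T v) (T v0)).
- by rewrite distrC; near: n.
- by rewrite distrC.
- by near: n.
Unshelve. all: by end_near. Qed.

(** Density supplies a single [v] of the subspace that is within the stability
    radius of [v0] and at which [T] differs little from [T v0]; the chain
    [T v0], [T v], [Tn n v], [Tn n v0] then has three small steps. *)
Lemma stable_converges_to (K : numFieldType) (V W : normedModType K)
    (T : V -> W) (Tn : nat -> V -> W) :
  continuous T -> consistent_with Tn T -> stable Tn -> converges_to Tn T.
Proof.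
move=> Tcont [V0 [_ V0dense TnT]] Tnstable v0; apply/cvgrPdist_le => eps eps0.
have e3 : 0 < eps / 3%:R by rewrite divr_gt0 ?ltr0n.
have [d d0 Tnd] := Tnstable v0 _ e3.
pose close v := `|v0 - v| <= d /\ `|T v0 - T v| <= eps / 3%:R.
have v0close : \forall v \near v0, close v.
  apply: filterI; first by move: (@cvg_id _ (nbhs v0)) => /cvgrPdist_le; exact.
  by move: (Tcont v0) => /cvgrPdist_le; exact.
(* Density speaks of open sets, so it is applied to the interior of close. *)
have [|v [/interior_subset[vd Tv] V0v]] := V0dense close^° _ (open_interior _).
  by exists v0.
have /cvgrPdist_le/(_ _ e3) TnTv := TnT v V0v.
have {}Tnd := Tnd v; rewrite distrC in Tnd; have {vd}Tnv := Tnd vd.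
near=> n; apply: (@ler_dist3_split _ _ (T v) (Tn n v)) => //; by near: n.
Unshelve. all: by end_near. Qed.

Theorem theorem3p5 (K : numFieldType) (V W : normedModType K)
    (T : {linear V -> W}) (hT : bounded_operator T)
    (Tn : nat -> V -> W) (hcons : consistent_with Tn T) :
  converges_to Tn T <-> stable Tn.
Proof.
have Tcont := bounded_operator_continuous _ _ _ _ hT.
split; first exact: converges_to_stable.
exact: stable_converges_to.
Qed.
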